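(* Let $(L,\cdot)$ be an LC-loop (respectively, an RC-loop) of exponent $3$. Then $L$ is centrum square if and only if $L$ is a cross inverse property loop.
   Context: An LC-loop is a loop satisfying $(xx)(yz)=(x(xy))z$ for all $x,y,z$; an RC-loop is a loop satisfying $(zy)(xx)=z((yx)x)$ for all $x,y,z$. A loop with identity $e$ has exponent $3$ if $x^3=e$ for all $x$. The centrum is $C(L)=\{a\in L: ax=xa\ \forall x\in L\}$; $L$ is centrum square if $x^2\in C(L)$ for all $x\in L$. For $x\in L$, $x^\rho$ denotes the right inverse, $x\,x^\rho=e$. $L$ is a cross inverse property loop if $xy\cdot x^\rho=y$ for all $x,y\in L$. *)

(* Defs.v *)
From HB Require Import structures.
From mathcomp Require Import all_boot boolp.

Set Implicit Arguments.
Unset Strict Implicit.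
Unset Printing Implicit Defensive.

Local Open Scope group_scope.

(* The mixin restates the unit laws, instead of building on umagmaType,
   because the latter requires a choiceType: the carrier of a loop is an
   arbitrary type. *)
HB.mixin Record BaseUMagma_isLoop L of BaseUMagma L := {
  loop_mul1x : left_id 1 (fun x y : L => x * y);
  loop_mulx1 : right_id 1 (fun x y : L => x * y);
  loop_ldiv : forall a b : L, exists! x : L, a * x = b;
  loop_rdiv : forall a b : L, exists! y : L, y * a = b
}.

#[short(type="loopType")]
HB.structure Definition Loop := {L of BaseUMagma_isLoop L & BaseUMagma L}.

Section LoopDefs.
Variable L : loopType.
Implicit Types x y z a : L.

Definition LC_loop := forall x y z, (x * x) * (y * z) = (x * (x * y)) * z.
Definition RC_loop := forall x y z, (z * y) * (x * x) = z * ((y * x) * x).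

(* x ^+ 3 is x * (x * x); the bracketing is immaterial in LC- and RC-loops,
   see LC_cube and RC_cube. *)
Definition exponent3 := forall x, x ^+ 3 = 1.

Definition centrum a := forall x, commute a x.
Definition centrum_square := forall x, centrum (x ^+ 2).

Fact rinv_subproof x : exists y, x * y = 1.
Proof. by have [y [xy1 _]] := loop_ldiv x 1; exists y. Qed.

Definition rinv x : L := sval (cid (rinv_subproof x)).

Lemma loop_mulxV x : x * rinv x = 1.
Proof. exact: svalP (cid (rinv_subproof x)). Qed.

Definition cross_inverse_property := forall x y, (x * y) * rinv x = y.

Lemma LC_cube : LC_loop -> forall x, x ^+ 3 = (x * x) * x.
Proof. by move=> lc x; have := lc x x 1; rewrite !loop_mulx1 => ->. Qed.

Lemma RC_cube : RC_loop -> forall x, x ^+ 3 = (x * x) * x.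
Proof. by move=> rc x; have := rc x x 1; rewrite !loop_mul1x => <-. Qed.

End LoopDefs.

Arguments LC_loop : clear implicits.
Arguments RC_loop : clear implicits.
Arguments exponent3 : clear implicits.
Arguments centrum_square : clear implicits.
Arguments cross_inverse_property : clear implicits.

(* Main.v *)
Require Import Defs.
From mathcomp Require Import all_boot.

(** In exponent 3 both identities collapse to associativity.  The LC
    identity says that every square lies in the left nucleus, because taking
    z = 1 in it gives x(xy) = (xx)y; dually the RC identity says that every
    square lies in the right nucleus.  In exponent 3 every element is a square,
    x = (xx)(xx), so the nucleus is everything and L is a group.

    In such an L, each of the two properties is equivalent to commutativity.
    For the centrum square property this is again because every element is a
    square.  For the cross inverse property it follows from (yx)x^rho =
    y(x x^rho) = y: the equation (xy)x^rho = y then amounts to xy = yx, by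
    cancellation of x^rho on the right. *)

Set Implicit Arguments.
Unset Strict Implicit.

Local Open Scope group_scope.

Section Exponent3.
Variable L : loopType.
Implicit Types x y z a : L.

Lemma loop_mulIx a : injective (fun x => x * a).
Proof.
move=> x y eq_xy; have [z [_ uniq_z]] := loop_rdiv a (x * a).
by rewrite -(uniq_z x erefl); apply: uniq_z.
Qed.

(** The element is the square of its inverse xx, as x^4 = x. *)
Lemma LC_exponent3_square :
  LC_loop L -> exponent3 L -> forall x, x = (x * x) * (x * x).
Proof.
move=> lc e3 x; have x3 : x * (x * x) = 1 := e3 x.
by rewrite lc x3 loop_mul1x.
Qed.

Lemma RC_exponent3_square :
  RC_loop L -> exponent3 L -> forall x, x = (x * x) * (x * x).
Proof.
move=> rc e3 x; have x3 : (x * x) * x = 1 by rewrite -RC_cube.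
by rewrite rc x3 loop_mulx1.
Qed.

Lemma LC_square_left_nucleus :
  LC_loop L -> forall x y z, (x * x) * (y * z) = ((x * x) * y) * z.
Proof.
move=> lc x y z; rewrite lc; congr (_ * z).
by have := lc x y 1; rewrite !loop_mulx1.
Qed.

Lemma RC_square_right_nucleus :
  RC_loop L -> forall x y z, z * (y * (x * x)) = (z * y) * (x * x).
Proof.
move=> rc x y z; rewrite rc; congr (z * _).
by have := rc x y 1; rewrite !loop_mul1x.
Qed.

Lemma LC_exponent3_assoc :
  LC_loop L -> exponent3 L -> associative (fun x y : L => x * y).
Proof.
move=> lc e3 x y z; rewrite (LC_exponent3_square lc e3 x).
exact: LC_square_left_nucleus.
Qed.

Lemma RC_exponent3_assoc :
  RC_loop L -> exponent3 L -> associative (fun x y : L => x * y).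
Proof.
move=> rc e3 x y z; rewrite (RC_exponent3_square rc e3 z).
exact: RC_square_right_nucleus.
Qed.

Lemma centrum_squareP :
  (forall x, x = (x * x) * (x * x)) ->
  centrum_square L <-> commutative (fun x y : L => x * y).
Proof.
move=> sq; split=> [cs x y | mulC x y]; last exact: mulC.
rewrite (sq x); exact: (cs (x * x) y).
Qed.

Lemma cross_inverse_propertyP :
  associative (fun x y : L => x * y) ->
  cross_inverse_property L <-> commutative (fun x y : L => x * y).
Proof.
move=> mulA.
have yxV x y : (y * x) * rinv x = y by rewrite -mulA loop_mulxV loop_mulx1.
split=> [cip x y | mulC x y]; last by rewrite [x * y]mulC yxV.
by apply: (@loop_mulIx (rinv x)); rewrite /= cip yxV.
Qed.

End Exponent3.

Theorem theorem6p1 (L : loopType) :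
  (LC_loop L -> exponent3 L -> (centrum_square L <-> cross_inverse_property L))
  /\
  (RC_loop L -> exponent3 L -> (centrum_square L <-> cross_inverse_property L)).
Proof.
split=> [lc e3 | rc e3].
  rewrite (centrum_squareP (LC_exponent3_square lc e3)).
  by rewrite (cross_inverse_propertyP (LC_exponent3_assoc lc e3)).
rewrite (centrum_squareP (RC_exponent3_square rc e3)).
by rewrite (cross_inverse_propertyP (RC_exponent3_assoc rc e3)).
Qed.
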